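(* Fix an integer base $b\ge2$. Let $0.a_1a_2a_3\dots\in[0,1)$ and suppose that for every $\epsilon>0$ there exists an increasing sequence $n_1<n_2<n_3<\dots$ of positive integers with asymptotic lower density greater than $1-\epsilon$ such that $0.a_{n_1}a_{n_2}a_{n_3}\dots$ is base-$b$ normal. Then $0.a_1a_2a_3\dots$ is base-$b$ normal.
   Context: For a digit sequence $(a_i)$ with $a_i\in\{0,\dots,b-1\}$, $0.a_1a_2a_3\dots$ is (base-$b$) normal if for every $k\ge1$ and every string $[d_1,\dots,d_k]$ of digits in $\{0,\dots,b-1\}$, $\lim_{n\to\infty}\frac{1}{n}\#\{0\le i\le n-1: a_{i+j}=d_j, j=1,\dots,k\}=b^{-k}$. The asymptotic lower density of $A\subset\mathbb{N}$ is $\liminf_{N\to\infty}|A\cap[1,N]|/N$. *)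

(* Defs.v *)
From HB Require Import structures.
From mathcomp Require Import all_boot all_order all_algebra.
From mathcomp Require Import all_classical all_reals all_analysis.

Set Implicit Arguments.
Unset Strict Implicit.
Unset Printing Implicit Defensive.

Import Order.TTheory GRing.Theory Num.Theory.
Import numFieldNormedType.Exports.

Local Open Scope classical_set_scope.
Local Open Scope ring_scope.

(* Sequences are indexed from 1, as in 0.a_1 a_2 a_3 ...: the value at index 0
   of a digit sequence or of an index sequence is never used. *)

Definition expansion_value (R : realType) (b : nat) (a : nat -> 'I_b) : R :=
  limn (fun n : nat => \sum_(1 <= i < n.+1) (a i)%:R / b%:R ^+ i : R).

(* #{0 <= i <= n-1 : a_{i+j} = d_j, j = 1, ..., k}; the ordinal j : 'I_k
   stands for the 1-based position j.+1 in the string. *)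
Definition occurrences (b : nat) (a : nat -> 'I_b) (k : nat)
    (d : k.-tuple 'I_b) (n : nat) : nat :=
  #|[set i : 'I_n | [forall j : 'I_k, a (i + j.+1)%N == tnth d j]]%SET|.

Definition base_normal (R : realType) (b : nat) (a : nat -> 'I_b) : Prop :=
  forall (k : nat) (d : k.-tuple 'I_b), (1 <= k)%N ->
    (fun n : nat => (occurrences a d n)%:R / n%:R : R) @ \oo
      --> (b%:R ^- k : R).

(* The term at N = 0 is 0 and does not affect the lower limit; the sequence
   takes values in [0, 1], so the real-valued limn_inf is meaningful. *)
Definition lower_density (R : realType) (A : set nat) : R :=
  limn_inf (fun N : nat => (count (mem A) (iota 1 N))%:R / N%:R : R).

Definition increasing_indices (n : nat -> nat) : Prop :=
  forall i : nat, (1 <= i)%N -> (0 < n i)%N /\ (n i < n i.+1)%N.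

Definition index_set (n : nat -> nat) : set nat :=
  n @` [set i : nat | (1 <= i)%N].

(* Main.v *)
(* Let m be the number of retained indices up to N. An occurrence in a_1 a_2 ...
   all of whose k positions are retained is an occurrence in the normal
   subsequence, starting among its first m positions; at most k (N + k - m) of
   the first N windows meet a deleted index. Since m >= (1 - eps) N eventually,
   every string of length k has upper frequency at most b^-k + k eps, for all
   eps. The frequencies of all b^k strings add up to 1, so the upper bounds
   force equality. *)
Require Import Defs.
From mathcomp Require Import all_boot all_order all_algebra.
From mathcomp Require Import all_classical all_reals all_analysis.
From mathcomp Require Import ring lra zify.

Import Order.TTheory GRing.Theory Num.Theory.
Import numFieldNormedType.Exports.

Local Open Scope classical_set_scope.
Local Open Scope ring_scope.

(** Packing the digits read from start [i] into a tuple turns an occurrence of [d] into an equality,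
    so each start matches exactly one [d]. *)
Definition window (b : nat) (a : nat -> 'I_b) (k i : nat) : k.-tuple 'I_b :=
  [tuple a (i + j.+1)%N | j < k].
Arguments window {b} a k i.

Definition counting (A : set nat) (N : nat) : nat :=
  count (mem A) (iota 1 N).

Lemma window_eqP (b : nat) (a : nat -> 'I_b) (k i : nat) (d : k.-tuple 'I_b) :
  reflect (forall j : 'I_k, a (i + j.+1)%N = tnth d j) (window a k i == d).
Proof.
apply: (iffP eqP) => [<- j|adP]; first by rewrite tnth_mktuple.
by apply: eq_from_tnth => j; rewrite tnth_mktuple.
Qed.

Lemma occurrences_count (b : nat) (a : nat -> 'I_b) (k : nat)
    (d : k.-tuple 'I_b) (n : nat) :
  occurrences a d n = count (fun i => window a k i == d) (iota 0 n).
Proof.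
rewrite /occurrences -sum1_card -sum1_count big_mkcond /=.
rewrite [RHS]big_mkcond (_ : iota 0 n = index_iota 0 n); last first.
  by rewrite /index_iota subn0.
rewrite big_mkord; apply: eq_bigr => i _; rewrite inE.
by congr (if _ then _ else _); apply/forallP/window_eqP => H j; apply/eqP/H.
Qed.

Lemma sum_occurrences (b : nat) (a : nat -> 'I_b) (k n : nat) :
  (\sum_(d : k.-tuple 'I_b) occurrences a d n)%N = n.
Proof.
under eq_bigr do rewrite occurrences_count -sum1_count big_mkcond /=.
rewrite exchange_big /= -[RHS](size_iota 0 n) -sum1_size.
by apply: eq_bigr => i _; rewrite -big_mkcond /= (big_pred1 (window a k i)).
Qed.

Section subsequence.
Variable n : nat -> nat.
Hypothesis n_incr : increasing_indices n.

Lemma indices_lt (s t : nat) : (1 <= s)%N -> (s < t)%N -> (n s < n t)%N.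
Proof.
move=> s1; elim: t => // t IH; rewrite ltnS leq_eqVlt => /orP[/eqP <-|st].
  by have [] := n_incr s s1.
have t1 : (1 <= t)%N by lia.
by apply: ltn_trans (IH st) _; have [] := n_incr t t1.
Qed.

Lemma indices_le (s t : nat) : (1 <= s)%N -> (s <= t)%N -> (n s <= n t)%N.
Proof.
by move=> s1; rewrite leq_eqVlt => /orP[/eqP <- //|/(indices_lt _ _ s1)/ltnW].
Qed.

(** Monotonicity makes [n 1], ..., [n t] distinct, and all of them lie in the index set between 1
    and [N]. *)
Lemma le_counting (t N : nat) :
  (1 <= t)%N -> (n t <= N)%N -> (t <= counting (index_set n) N)%N.
Proof.
move=> t1 ntN; rewrite /counting -size_filter -{1}(size_iota 1 t).
rewrite -(size_map n); apply: uniq_leq_size.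
  rewrite map_inj_in_uniq ?iota_uniq // => x y; rewrite !mem_iota => x1 y1 xy.
  by have [/indices_lt|/indices_lt|//] := ltngtP x y; rewrite ?xy; lia.
move=> y /mapP[x]; rewrite mem_iota => /andP[x1 xt] -> {y}.
rewrite mem_filter mem_iota; apply/andP; split.
  by apply/mem_set; exists x.
have [-> _] := n_incr x x1; rewrite add1n ltnS /=.
by apply: leq_trans ntN; apply: indices_le => //; lia.
Qed.

(** No retained index can be skipped: [n (t + j).+1] exceeds [i + j], while [i + j.+1] is some
    [n u], and [u] must come after [t + j], so [n (t + j).+1] is at most [i + j.+1]. *)
Lemma consecutive_indices (k t i : nat) :
  (1 <= t)%N -> n t = i ->
  (forall j, (j < k)%N -> index_set n (i + j)%N) ->
  forall j, (j < k)%N -> n (t + j)%N = (i + j)%N.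
Proof.
move=> t1 nti iA; elim=> [|j IH] jk; first by rewrite !addn0.
have ntj := IH (ltnW jk).
have [u /= u1 nu] := iA _ jk.
have [_] := n_incr (t + j)%N ltac:(lia); rewrite -addnS ntj => ltj.
suff : (n (t + j.+1) <= n u)%N by lia.
apply: indices_le; first by lia.
have [ut|] := leqP u (t + j)%N; last by lia.
by have := indices_le _ _ u1 ut; lia.
Qed.

(** Union bound over the [k] offsets in a window: each offset hits a deleted index for at most
    [N + k - counting (index_set n) N] starts. *)
Lemma count_missing_window (k N : nat) :
  (count (fun i => ~~ [forall j : 'I_k, (i + j.+1)%N \in index_set n])
     (iota 0 N)
   <= k * (N + k - counting (index_set n) N))%N.
Proof.
have missing j : (j < k)%N ->
  (count (fun i => (i + j.+1)%N \notin index_set n) (iota 0 N)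
     <= N + k - counting (index_set n) N)%N.
  move=> jk.
  have -> : count (fun i => (i + j.+1)%N \notin index_set n) (iota 0 N)
      = count (predC (mem (index_set n))) (iota j.+1 N).
    rewrite -[j.+1 in RHS]addn0 iotaDl count_map; apply: eq_count => i /=.
    by rewrite addnC.
  have := count_predC (mem (index_set n)) (iota 1 N).
  rewrite size_iota -/(counting _ N) => cN.
  (* The positions read at offset [j] form the last [N] entries of [iota 1 (j + N)]; going beyond
     [N] adds at most [j] deleted indices. *)
  have cNj : (count (predC (mem (index_set n))) (iota 1 (j + N))
      <= N + j - counting (index_set n) N)%N.
    rewrite addnC iotaD count_cat.
    have := count_size (predC (mem (index_set n))) (iota (1 + N) j).
    by rewrite size_iota; lia.
  move: cNj; rewrite iotaD count_cat add1n; lia.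
rewrite -sum1_count big_mkcond /=.
apply: (@leq_trans (\sum_(i <- iota 0 N)
    \sum_(j < k) ((i + j.+1)%N \notin index_set n))%N).
  apply: leq_sum => i _; case: ifP => //; rewrite negb_forall => /existsP[j jA].
  by rewrite (bigD1 j) //= jA.
rewrite exchange_big /= -[k in (k * _)%N]card_ord -sum_nat_const.
apply: leq_sum => j _; apply: leq_trans (missing j (ltn_ord j)).
by rewrite -sum1_count [in leqRHS]big_mkcond /=; apply: leq_sum => i _; case: ifP.
Qed.

Lemma occurrences_le_subsequence (b : nat) (a : nat -> 'I_b) (k : nat)
    (d : k.-tuple 'I_b) (N : nat) : (1 <= k)%N ->
  (occurrences a d N
   <= occurrences (fun i => a (n i)) d (counting (index_set n) N)
      + k * (N + k - counting (index_set n) N))%N.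
Proof.
move=> k1; rewrite !occurrences_count.
set P := fun i => window a k i == d.
set G := fun i => [forall j : 'I_k, (i + j.+1)%N \in index_set n].
apply: (@leq_trans (count (predI P G) (iota 0 N)
                    + count (predC G) (iota 0 N))%N).
  rewrite -count_predUI; apply: leq_trans (leq_addr _ _).
  by apply: sub_count => i /= ->; case: (G i).
apply: leq_add; last exact: count_missing_window.
(* A window starting at [s] reads from position [s.+1], so a start [s] in the subsequence
   corresponds to the start [(n s.+1).-1] in [a]. Every fully retained occurrence is shown to arise
   in this way. *)
rewrite -!size_filter -[leqRHS](size_map (fun s => (n s.+1).-1)).
apply: uniq_leq_size; first by rewrite filter_uniq ?iota_uniq.
move=> i; rewrite mem_filter mem_iota /= => /andP[/andP[/window_eqP iP]].
move=> /forallP iG iN.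
have iA j : (j < k)%N -> index_set n (i.+1 + j)%N.
  by move=> jk; have := iG (Ordinal jk); rewrite inE /= addnS.
have [t /= t1 nt] := iA 0%N k1; rewrite addn0 in nt.
have ntj := consecutive_indices _ _ _ t1 nt iA.
apply/mapP; exists t.-1; last by rewrite prednK // nt.
rewrite mem_filter mem_iota /= add0n; apply/andP; split.
  apply/window_eqP => j; rewrite -iP; congr a.
  by rewrite addnS -addSn prednK // ntj // addSn addnS.
by rewrite prednK //; apply: le_counting => //; rewrite nt; lia.
Qed.

End subsequence.

Lemma counting_le (A : set nat) (N : nat) : (counting A N <= N)%N.
Proof. by rewrite -[leqRHS](size_iota 1) count_size. Qed.

(** For a bounded sequence the lower limit is the supremum of the tail infima, so one tail infimum
    exceeds [r], and with it every term of that tail. *)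
Lemma lt_limn_inf_near (R : realType) (u : nat -> R) (r : R) :
  bounded_fun u -> r < limn_inf u -> \forall N \near \oo, r < u N.
Proof.
move=> ub; rewrite limn_infE // => /sup_gt[].
  by exists (infs u 0%N), 0%N.
move=> _ [m _ <-] rm; exists m => // N /= mN; apply: lt_le_trans rm _.
by apply: ge_inf; [exact/has_lbound_sdrop/bounded_fun_has_lbound|exists N].
Qed.

Lemma lower_density_near (R : realType) (A : set nat) (r : R) :
  r < lower_density R A ->
  \forall N \near \oo, r * N%:R <= (counting A N)%:R.
Proof.
move=> rA; have : \forall N \near \oo, r < (counting A N)%:R / N%:R.
  apply: lt_limn_inf_near rA; exists 1; split => // x x1 N _ /=.
  apply: le_trans (ltW x1); rewrite ger0_norm ?divr_ge0 //.
  have [->|N0] := posnP N; first by rewrite invr0 mulr0.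
  by rewrite ler_pdivrMr ?ltr0n // mul1r ler_nat counting_le.
move=> h; near=> N; have N0 : (0 < N)%N by near: N; exact: nbhs_infty_gt.
by rewrite -ler_pdivlMr ?ltr0n //; apply/ltW; near: N.
Unshelve. all: by end_near. Qed.

(** The occurrences of all [b ^ k] strings add up to [N], so upper bounds for the strings other than
    [d] leave a lower bound for [d]. *)
Lemma base_normal_of_upper (R : realType) (b : nat) (a : nat -> 'I_b) :
  (0 < b)%N ->
  (forall (k : nat) (d : k.-tuple 'I_b), (1 <= k)%N -> forall e : R, 0 < e ->
     \forall N \near \oo,
       (occurrences a d N)%:R <= (b%:R ^- k + e) * N%:R :> R) ->
  base_normal R a.
Proof.
move=> b0 upper k d k1; apply/cvgrPdist_le => e e0.
have B0 : 0 < b%:R ^+ k :> R by rewrite exprn_gt0 ?ltr0n.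
(* The tolerance is divided by [b ^ k] because the errors of the [b ^ k - 1] other strings
   accumulate in the lower bound for [d]. *)
have all_le : \forall N \near \oo, forall d' : k.-tuple 'I_b,
    (occurrences a d' N)%:R <= (b%:R ^- k + e / b%:R ^+ k) * N%:R :> R.
  by apply: filter_forall => d'; apply: upper => //; rewrite divr_gt0.
near=> N.
have N0 : 0 < N%:R :> R by rewrite ltr0n; near: N; exact: nbhs_infty_gt.
have dN : (occurrences a d N)%:R <= (b%:R ^- k + e) * N%:R :> R.
  by near: N; exact: upper.
have all_leN : forall d' : k.-tuple 'I_b,
    (occurrences a d' N)%:R <= (b%:R ^- k + e / b%:R ^+ k) * N%:R :> R.
  by near: N.
have sumN : (occurrences a d N)%:R
    + \sum_(d' | d' != d) (occurrences a d' N)%:R = N%:R :> R.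
  by rewrite -[in RHS](sum_occurrences b a k N) natr_sum [RHS](bigD1 d).
have others : \sum_(d' | d' != d) (occurrences a d' N)%:R
    <= (b%:R ^+ k - 1) * ((b%:R ^- k + e / b%:R ^+ k) * N%:R) :> R.
  apply: le_trans (ler_sum _ (fun d' _ => all_leN d')) _.
  rewrite sumr_const -[leLHS]mulr_natl; apply: ler_wpM2r.
    by rewrite mulr_ge0 ?addr_ge0 ?divr_ge0 ?invr_ge0 // ltW.
  have := cardC1 d; rewrite card_tuple card_ord => cd.
  have -> : #|(fun d' : k.-tuple 'I_b => d' != d)| = (b ^ k).-1.
    by rewrite -cd; apply: eq_card.
  by rewrite -subn1 natrB ?expn_gt0 ?b0 // natrX.
have f_eq : (occurrences a d N)%:R / N%:R * N%:R = (occurrences a d N)%:R :> R.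
  by rewrite divfK // gt_eqF.
have Bq : b%:R ^+ k * b%:R ^- k = 1 :> R by rewrite mulfV // gt_eqF.
have q0 : 0 < b%:R ^- k :> R by rewrite invr_gt0.
rewrite ler_norml; apply/andP; split; rewrite -(ler_pM2r N0) mulrBl f_eq.
  by rewrite mulNr lerBrDl lerBlDr -mulrDl.
have {}others : \sum_(d' | d' != d) (occurrences a d' N)%:R
    <= (1 + e - b%:R ^- k - e * b%:R ^- k) * N%:R :> R.
  apply: le_trans others _; rewrite le_eqVlt; apply/orP; left; apply/eqP.
  rewrite mulrA; congr (_ * _); rewrite -[e / _]/(e * b%:R ^- k).
  rewrite mulrBl mul1r mulrDr (mulrCA _ e) Bq; ring.
have eqN : 0 <= e * b%:R ^- k * N%:R by rewrite !mulr_ge0 // ltW.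
lra.
Unshelve. all: by end_near. Qed.

Theorem theorem1p3 (R : realType) (b : nat) (hb : (2 <= b)%N)
    (a : nat -> 'I_b)
    (ha : 0 <= expansion_value R a < 1)
    (hsub : forall eps : R, 0 < eps ->
      exists n : nat -> nat,
        [/\ increasing_indices n,
            1 - eps < lower_density R (index_set n)
          & base_normal R (fun i : nat => a (n i))]) :
  base_normal R a.
Proof.
apply: base_normal_of_upper => [|k d k1 e e0]; first lia.
have k0 : 0 < k%:R :> R by rewrite ltr0n.
(* The first bound keeps the loss [k * eps] from deleted indices below [e / 4]; the second retains
   at least half of the indices eventually, so that [m] grows with [N]. *)
pose eps : R := Num.min (e / (4 * k%:R)) (1 / 2).
have eps0 : 0 < eps by rewrite lt_min !divr_gt0 // mulr_gt0.
have [n [n_incr /lower_density_near dens nor]] := hsub eps eps0.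
have eps_half : eps <= 1 / 2 by rewrite ge_min lexx orbT.
have eps_k : k%:R * eps <= e / 4.
  rewrite mulrC -ler_pdivlMr // -mulrA -invfM.
  by rewrite ge_min lexx.
have e4 : 0 < e / 4 by rewrite divr_gt0.
have [M _ hM] : \forall m \near \oo,
    (occurrences (fun i => a (n i)) d m)%:R <= (b%:R ^- k + e / 4) * m%:R :> R.
  move/(_ k d k1)/cvgrPdist_le/(_ _ e4) : nor => nor; near=> m.
  have m0 : 0 < m%:R :> R by rewrite ltr0n; near: m; exact: nbhs_infty_gt.
  rewrite -ler_pdivrMr // -lerBlDl; apply: le_trans (ler_norm _) _.
  by rewrite distrC; near: m.
near=> N.
have dN : (1 - eps) * N%:R <= (counting (index_set n) N)%:R by near: N.
(* This gives [M <= m], since [m] is at least [N / 2]. The next bound absorbs the boundary term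
   [k * k] into [e / 4 * N]. *)
have NM : 2 * M%:R <= N%:R :> R by near: N; exact: nbhs_infty_ger.
have Nk : k%:R * k%:R / (e / 4) <= N%:R by near: N; exact: nbhs_infty_ger.
rewrite ler_pdivrMr // in Nk.
set m := counting (index_set n) N in dN.
have mN : m%:R <= N%:R :> R by rewrite ler_nat counting_le.
have N0 : 0 <= N%:R :> R by [].
have Mm : (M <= m)%N by rewrite -(ler_nat R); nra.
have := hM m Mm; rewrite /= => occ_m.
have := occurrences_le_subsequence _ n_incr _ a _ d N k1.
rewrite -/m -(ler_nat R) natrD natrM natrB ?natrD; last first.
  by apply: leq_trans (counting_le _ _) (leq_addr _ _).
have q0 : 0 <= b%:R ^- k :> R by rewrite invr_ge0 exprn_ge0.
have : (b%:R ^- k + e / 4) * m%:R <= (b%:R ^- k + e / 4) * N%:R.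
  by rewrite ler_wpM2l // addr_ge0 // ltW.
have : k%:R * (N%:R - m%:R) <= (e / 4) * N%:R.
  apply: le_trans (ler_wpM2r N0 eps_k); rewrite -mulrA ler_wpM2l //; lra.
have := mulr_ge0 (ltW e0) N0.
(* Normality of the subsequence, the deleted indices and the boundary term cost [e / 4] each, for a
   total of [3 * e / 4], within the allowed [e]. *)
nra.
Unshelve. all: by end_near. Qed.
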